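(* Let $n\in\mathbb{N}$, $n\geq 1$. For $i=1,2,\dots,n$ let $R_i$ be a commutative ring with identity, $M_i$ an $R_i$-module, and $S_i$ a multiplicatively closed subset of $R_i$. Let $M=M_1\times\cdots\times M_n$, $R=R_1\times\cdots\times R_n$ and $S=S_1\times\cdots\times S_n$, where $M$ is regarded as an $R$-module with componentwise addition and scalar multiplication. Then the following statements are equivalent: (a) $M$ is a fully $S$-idempotent $R$-module; (b) $M_i$ is a fully $S_i$-idempotent $R_i$-module for each $i\in\{1,2,\dots,n\}$.
   Context: For a commutative ring $A$ with identity, an $A$-module $X$ and a submodule $N$ of $X$, $(N:_A X)=\{a\in A : aX\subseteq N\}$. For a multiplicatively closed subset $T$ of $A$, a submodule $N$ of $X$ is a $T$-idempotent submodule if there exists $t\in T$ such that $tN\subseteq (N:_A X)^2X\subseteq N$; $X$ is a fully $T$-idempotent $A$-module if every submodule of $X$ is a $T$-idempotent submodule. *)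

(* Defs.v *)
From HB Require Import structures.
From mathcomp Require Import all_boot all_algebra.
From mathcomp Require Import boolp classical_sets.

Set Implicit Arguments.
Unset Strict Implicit.
Unset Printing Implicit Defensive.

Import GRing.Theory.

Local Open Scope classical_set_scope.
Local Open Scope ring_scope.

(* The library has no product of a dependent family of rings or modules, only
   {ffun I -> R}. The three aliases below carry the componentwise structures on
   {dffun forall i, _}; being aliases, they do not interfere with the existing
   instances on finite functions. *)

Section ProductZmodule.
Variables (I : finType) (V : I -> zmodType).

Definition prod_zmod : Type := {dffun forall i, V i}.
HB.instance Definition _ := Choice.copy prod_zmod {dffun forall i, V i}.

Implicit Types u v w : prod_zmod.

Definition prod_zero : prod_zmod := [ffun i => 0].
Definition prod_opp u : prod_zmod := [ffun i => - u i].
Definition prod_add u v : prod_zmod := [ffun i => u i + v i].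

Fact prod_addA : associative prod_add.
Proof. by move=> u v w; apply/ffunP => i; rewrite !ffunE addrA. Qed.
Fact prod_addC : commutative prod_add.
Proof. by move=> u v; apply/ffunP => i; rewrite !ffunE addrC. Qed.
Fact prod_add0 : left_id prod_zero prod_add.
Proof. by move=> u; apply/ffunP => i; rewrite !ffunE add0r. Qed.
Fact prod_addN : left_inverse prod_zero prod_opp prod_add.
Proof. by move=> u; apply/ffunP => i; rewrite !ffunE addNr. Qed.

HB.instance Definition _ :=
  GRing.isZmodule.Build prod_zmod prod_addA prod_addC prod_add0 prod_addN.

End ProductZmodule.

Section ProductRing.
Variables (I : finType) (R : I -> comPzRingType).

Definition prod_ring : Type := prod_zmod R.
HB.instance Definition _ := GRing.Zmodule.copy prod_ring (prod_zmod R).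

Implicit Types a b c : prod_ring.

Definition prod_one : prod_ring := [ffun i => 1].
Definition prod_mul a b : prod_ring := [ffun i => a i * b i].

Fact prod_mulA : associative prod_mul.
Proof. by move=> a b c; apply/ffunP => i; rewrite !ffunE mulrA. Qed.
Fact prod_mulC : commutative prod_mul.
Proof. by move=> a b; apply/ffunP => i; rewrite !ffunE mulrC. Qed.
Fact prod_mul1 : left_id prod_one prod_mul.
Proof. by move=> a; apply/ffunP => i; rewrite !ffunE mul1r. Qed.
Fact prod_mulDl : left_distributive prod_mul +%R.
Proof. by move=> a b c; apply/ffunP => i; rewrite !ffunE mulrDl. Qed.

HB.instance Definition _ := GRing.Zmodule_isComPzRing.Build prod_ring
  prod_mulA prod_mulC prod_mul1 prod_mulDl.

End ProductRing.

Section ProductModule.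
Variables (I : finType) (R : I -> comPzRingType).
Variable M : forall i, lmodType (R i).

Definition prod_mod : Type := prod_zmod M.
HB.instance Definition _ := GRing.Zmodule.copy prod_mod (prod_zmod M).

Implicit Types (a b : prod_ring R) (x y : prod_mod).

Definition prod_scale a x : prod_mod := [ffun i => a i *: x i].

Fact prod_scaleA a b x : prod_scale a (prod_scale b x) = prod_scale (a * b) x.
Proof. by apply/ffunP => i; rewrite !ffunE scalerA. Qed.
Fact prod_scale1 : left_id 1 prod_scale.
Proof. by move=> x; apply/ffunP => i; rewrite !ffunE scale1r. Qed.
Fact prod_scaleDr : right_distributive prod_scale +%R.
Proof. by move=> a x y; apply/ffunP => i; rewrite !ffunE scalerDr. Qed.
Fact prod_scaleDl x : {morph prod_scale^~ x : a b / a + b}.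
Proof. by move=> a b; apply/ffunP => i; rewrite !ffunE scalerDl. Qed.

HB.instance Definition _ := GRing.Zmodule_isLmodule.Build (prod_ring R) prod_mod
  prod_scaleA prod_scale1 prod_scaleDr prod_scaleDl.

End ProductModule.

Definition prod_set (I : finType) (R : I -> comPzRingType)
    (S : forall i, set (R i)) : set (prod_ring R) :=
  [set s | forall i, S i (s i)].

Section Idempotent.
Variable A : comPzRingType.

Definition colon (X : lmodType A) (N : set X) : set A :=
  [set a | [set a *: x | x in [set: X]] `<=` N].

(* J N, the set of all finite sums of products a *: x with a in J, x in N. *)
Definition ideal_mul (X : lmodType A) (J : set A) (N : set X) : set X :=
  [set y | exists (k : nat) (a : 'I_k -> A) (x : 'I_k -> X),
     [/\ forall j, J (a j), forall j, N (x j) & y = \sum_(j < k) a j *: x j]].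

(* The product of ideals J J, computed in A as a module over itself. *)
Definition ideal_sq (J : set A) : set A := @ideal_mul A^o J J.

Variable T : set A.

Definition idempotent_submod (X : lmodType A) (N : set X) : Prop :=
  exists2 t : A, T t &
    [set t *: x | x in N] `<=` ideal_mul (ideal_sq (colon N)) [set: X] /\
    ideal_mul (ideal_sq (colon N)) [set: X] `<=` N.

Definition fully_idempotent (X : lmodType A) : Prop :=
  forall N : set X, GRing.submod_closed [in N] -> idempotent_submod N.

End Idempotent.

(* Main.v *)
Require Import Defs.
From HB Require Import structures.
From mathcomp Require Import all_boot all_algebra.
From mathcomp Require Import boolp classical_sets.

(* Every submodule N of the product satisfies N = prod_i N_i, where N_i consists
   of the x in M_i whose image under the i-th injection lies in N. Injections and
   projections are semilinear and carry (N : M) to (N_i : M_i) and back, hence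
   also (N : M)^2 M to (N_i : M_i)^2 M_i and back. The index set being finite, an
   element of the product is the sum of the injections of its components, and the
   elements t_i of S_i may be collected into a single element of S. *)

Set Implicit Arguments.
Unset Strict Implicit.
Unset Printing Implicit Defensive.

Import GRing.Theory.

Local Open Scope classical_set_scope.
Local Open Scope ring_scope.

Section SubmoduleClosure.
Variables (A : pzRingType) (X : lmodType A) (N : set X).

Lemma submod_closedE :
  GRing.submod_closed [in N] <->
  N 0 /\ forall (a : A) x y, N x -> N y -> N (a *: x + y).
Proof.
split=> -[N0 NP]; split.
- by move: N0; rewrite inE.
- by move=> a x y Nx Ny; have := NP a x y; rewrite !inE; apply.
- by rewrite inE.
- by move=> a x y; rewrite !inE; apply: NP.
Qed.

Hypothesis subN : GRing.submod_closed [in N].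

Lemma submod_set0 : N 0.
Proof. by case/submod_closedE: subN. Qed.

Lemma submod_setD x y : N x -> N y -> N (x + y).
Proof. by move=> Nx Ny; rewrite -[x]scale1r; apply: (submod_closedE.1 subN).2. Qed.

Lemma submod_setZ a x : N x -> N (a *: x).
Proof.
by move=> Nx; rewrite -[_ *: _]addr0; apply: (submod_closedE.1 subN).2 submod_set0.
Qed.

Lemma submod_set_sum k (x : 'I_k -> X) :
  (forall j, N (x j)) -> N (\sum_(j < k) x j).
Proof. by move=> Nx; elim/big_ind: _ => // [|u v]; [apply: submod_set0|apply: submod_setD]. Qed.

End SubmoduleClosure.

Section IdealMul.
Variable A : comPzRingType.
Implicit Type X : lmodType A.

Lemma ideal_mul0 X (J : set A) (N : set X) : ideal_mul J N 0.
Proof.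
by exists 0%N, (fun=> 0), (fun=> 0); split; [case|case|rewrite big_ord0].
Qed.

Lemma ideal_mulD X (J : set A) (N : set X) y z :
  ideal_mul J N y -> ideal_mul J N z -> ideal_mul J N (y + z).
Proof.
move=> [k [a [x [Ja Nx ->]]]] [l [b [w [Jb Nw ->]]]].
(* The two sums are concatenated: [split] sends an index below [k] to the first family and the
   others to the second. *)
exists (k + l)%N,
  (fun j => match split j with inl u => a u | inr v => b v end),
  (fun j => match split j with inl u => x u | inr v => w v end).
split=> [j|j|]; [by case: split..|rewrite big_split_ord].
by congr (_ + _); apply: eq_bigr => j _;
  [rewrite (unsplitK (inl j))|rewrite (unsplitK (inr j))].
Qed.

(** Expanding both sums leaves terms $(bc)x = b(cx)$, and $b \in (N : X)$ sends $cx$ into $N$. *)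
Lemma ideal_mul_colon_sub X (N : set X) : GRing.submod_closed [in N] ->
  ideal_mul (ideal_sq (colon N)) [set: X] `<=` N.
Proof.
move=> subN _ [k [a [x [Ja _ ->]]]]; apply: (submod_set_sum subN) => j.
have [l [b [c [Jb Jc ->]]]] := Ja j.
rewrite scaler_suml; apply: (submod_set_sum subN) => m.
(* Scaling in [A^o] is multiplication in [A] by conversion. *)
rewrite -[b m *: c m]/(b m * c m) -scalerA.
by apply: (Jb m); exists (c m *: x j).
Qed.

(** The second inclusion is automatic for a submodule, so only the first one is left, stated
    pointwise. *)
Lemma idempotent_submodP (T : set A) X (N : set X) :
  GRing.submod_closed [in N] ->
  idempotent_submod T N <->
  exists2 t, T t &
    forall x, N x -> ideal_mul (ideal_sq (colon N)) [set: X] (t *: x).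
Proof.
move=> subN; split=> -[t Tt].
  by case=> tN _; exists t => // x Nx; apply: tN; exists x.
move=> tN; exists t => //; split; last exact: ideal_mul_colon_sub.
by move=> _ [x Nx <-]; apply: tN.
Qed.

End IdealMul.

Section IdealMulMap.
Variables (A B : comPzRingType) (f : A -> B).

Lemma ideal_mul_map (X : lmodType A) (Y : lmodType B) (g : X -> Y)
    (J : set A) (J' : set B) (N : set X) (N' : set Y) :
    {morph g : x y / x + y} -> (forall a x, g (a *: x) = f a *: g x) ->
    (forall a, J a -> J' (f a)) -> (forall x, N x -> N' (g x)) ->
  forall y, ideal_mul J N y -> ideal_mul J' N' (g y).
Proof.
move=> gD gZ fJ gN _ [k [a [x [Ja Nx ->]]]].
have g0 : g 0 = 0 by apply: (addrI (g 0)); rewrite -gD !addr0.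
exists k, (f \o a), (g \o x); split=> [j|j|]; [exact: fJ|exact: gN|].
by rewrite (big_morph g gD g0); apply: eq_bigr => j _; apply: gZ.
Qed.

(** The conditions on [f] are sums and products only: the injection of a factor ring into the
    product need not send 1 to 1, and this form covers projections and injections alike. *)
Lemma ideal_mul_sq_map (X : lmodType A) (Y : lmodType B) (g : X -> Y)
    (J : set A) (J' : set B) :
    {morph f : a b / a + b} -> {morph f : a b / a * b} ->
    {morph g : x y / x + y} -> (forall a x, g (a *: x) = f a *: g x) ->
    (forall a, J a -> J' (f a)) ->
  forall y, ideal_mul (ideal_sq J) [set: X] y ->
    ideal_mul (ideal_sq J') [set: Y] (g y).
Proof.
move=> fD fM gD gZ fJ; apply: ideal_mul_map => //.
(* With each ring a module over itself, [f] is also the module map, and [fM] is its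
   semilinearity. *)
exact: (@ideal_mul_map A^o B^o f).
Qed.

End IdealMulMap.

Section Injection.
Variables (I : finType) (V : I -> zmodType).

(** [dfwith] overrides the zero family at [i], which avoids a cast between [V i] and [V j]. *)
Definition prod_inj (i : I) (x : V i) : prod_zmod V :=
  [ffun j => dfwith (fun k => 0 : V k) x j].

Lemma prod_injE i (x : V i) : prod_inj x i = x.
Proof. by rewrite ffunE dfwith_in. Qed.

Lemma prod_injN i j (x : V i) : i != j -> prod_inj x j = 0.
Proof. by move=> ij; rewrite ffunE dfwith_out. Qed.

Lemma prod_addE (u v : prod_zmod V) i : (u + v) i = u i + v i.
Proof. by rewrite ffunE. Qed.

Lemma prod_injD i : {morph @prod_inj i : x y / x + y}.
Proof.
move=> x y; apply/ffunP => j; rewrite prod_addE.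
have [<-|ij] := eqVneq i j; first by rewrite !prod_injE.
by rewrite !prod_injN // addr0.
Qed.

Lemma prod_inj0 i : prod_inj (0 : V i) = 0.
Proof. by apply: (addrI (prod_inj (0 : V i))); rewrite -prod_injD !addr0. Qed.

Lemma prod_sum_inj (u : prod_zmod V) : u = \sum_i prod_inj (u i).
Proof.
apply/ffunP => j.
rewrite (big_morph (fun v : prod_zmod V => v j) (fun v w => prod_addE v w j)
  (ffunE _ _)).
rewrite (bigD1 j) //= prod_injE big1 ?addr0 // => i ij.
exact: prod_injN.
Qed.

End Injection.

Section InjectionModule.
Variables (I : finType) (R : I -> comPzRingType).
Variable M : forall i, lmodType (R i).

Lemma prod_scaleE (a : prod_ring R) (x : prod_mod M) i :
  (a *: x) i = a i *: x i.
Proof. by rewrite ffunE. Qed.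

Lemma prod_scale_inj (a : prod_ring R) i (x : M i) :
  a *: (prod_inj x : prod_mod M) = prod_inj (a i *: x).
Proof.
apply/ffunP => j; rewrite prod_scaleE.
have [<-|ij] := eqVneq i j; first by rewrite !prod_injE.
by rewrite !prod_injN // scaler0.
Qed.

(** A scalar supported at [i] kills all other components; for [a = 1] it cuts an element down to its
    [i]-th component. *)
Lemma prod_inj_scale i (a : R i) (x : prod_mod M) :
  (prod_inj a : prod_ring R) *: x = prod_inj (a *: x i).
Proof.
apply/ffunP => j; rewrite prod_scaleE.
have [<-|ij] := eqVneq i j; first by rewrite !prod_injE.
by rewrite !prod_injN // scale0r.
Qed.

Lemma prod_injM i : {morph (@prod_inj I R i : R i -> prod_ring R) : a b / a * b}.
Proof.
move=> a b; apply/ffunP => j; rewrite [RHS]ffunE.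
have [<-|ij] := eqVneq i j; first by rewrite !prod_injE.
by rewrite !prod_injN // mulr0.
Qed.

Lemma fully_idempotent_component (S : forall i, set (R i)) i :
  fully_idempotent (prod_set S) (prod_mod M) ->
  fully_idempotent (S i) (M i).
Proof.
move=> idemM N subN.
(* The hypothesis is applied to the preimage of [N] under the [i]-th projection, and its conclusion
   is projected back. *)
pose P : set (prod_mod M) := [set x | N (x i)].
have subP : GRing.submod_closed [in P].
  apply/submod_closedE; split; first by rewrite /P /= ffunE; apply: submod_set0.
  move=> a x y Px Py; rewrite /P /= prod_addE prod_scaleE.
  exact: (submod_setD subN (submod_setZ subN _ Px)).
have /(idempotent_submodP _ subP)[t St tP] := idemM P subP.
apply/(idempotent_submodP _ subN); exists (t i); first exact: St.
move=> x Nx; rewrite -(@prod_injE I M i x) -prod_scaleE.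
apply: (@ideal_mul_sq_map _ _ (fun a : prod_ring R => a i) _ _
  (fun y : prod_mod M => y i) (colon P)).
- by move=> a b; rewrite ffunE.
- by move=> a b; rewrite ffunE.
- by move=> y z; rewrite ffunE.
- by move=> a y; rewrite ffunE.
(* That [a i] sends [z] into [N] is read off from the action of [a] on [prod_inj z]. *)
- move=> a aP _ [z _ <-]; rewrite -(@prod_injE I M i z) -prod_scaleE.
  by apply: aP; exists (prod_inj z).
- by apply: tP; rewrite /P /= prod_injE.
Qed.

Lemma fully_idempotent_prod (S : forall i, set (R i)) :
  (forall i, fully_idempotent (S i) (M i)) ->
  fully_idempotent (prod_set S) (prod_mod M).
Proof.
move=> idemM P subP.
pose N i : set (M i) := [set x | P (prod_inj x)].
have subN i : GRing.submod_closed [in N i].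
  apply/submod_closedE; split.
    by rewrite /N /= prod_inj0; apply: (submod_set0 subP).
  move=> a x y Nx Ny; rewrite /N /= prod_injD.
  apply: (submod_setD subP) => //.
  have := submod_setZ subP (prod_inj a : prod_ring R) Nx.
  by rewrite prod_inj_scale prod_injE.
have injP (x : prod_mod M) i : P x -> N i (x i).
  move=> Px; rewrite /N /= -[x i]scale1r -prod_inj_scale.
  exact: submod_setZ.
have tP i : exists t : R i, S i t /\
    forall x : M i, N i x -> ideal_mul (ideal_sq (colon (N i))) setT (t *: x).
  by have /(idempotent_submodP _ (subN i))[t] := idemM i _ (subN i); exists t.
(* One multiplier is chosen for each index; together they form an element of [prod_set S]. *)
pose t : prod_ring R := [ffun i => projT1 (cid (tP i))].
apply/(idempotent_submodP _ subP); exists t.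
  by move=> i; rewrite ffunE; case: cid => /= u [].
(* Since [ideal_mul] is closed under sums, it suffices to treat each summand
   [prod_inj (t i *: x i)], the image of an element supplied by the [i]-th factor. *)
move=> x Px; rewrite [x]prod_sum_inj scaler_sumr.
elim/big_ind: _ => [||i _]; [exact: ideal_mul0|exact: ideal_mulD|].
rewrite prod_scale_inj ffunE; case: cid => /= u [_ uN].
apply: (@ideal_mul_sq_map _ _ (@prod_inj I R i : R i -> prod_ring R)
  (M i) (prod_mod M) (@prod_inj I M i) (colon (N i))).
- exact: prod_injD.
- exact: prod_injM.
- exact: prod_injD.
- by move=> a y; rewrite prod_inj_scale prod_injE.
- move=> a aN _ [y _ <-]; rewrite prod_inj_scale.
  by apply: aN; exists (y i).
- exact: uN (injP x i Px).
Qed.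

End InjectionModule.

Theorem theorem2p15 (n : nat) (hn : (1 <= n)%N)
    (R : 'I_n -> comPzRingType) (M : forall i : 'I_n, lmodType (R i))
    (S : forall i : 'I_n, set (R i))
    (hS : forall i : 'I_n, GRing.mulr_closed [in S i]) :
  fully_idempotent (prod_set S) (prod_mod M) <->
  (forall i : 'I_n, fully_idempotent (S i) (M i)).
Proof.
split; last exact: fully_idempotent_prod.
by move=> idemM i; apply: fully_idempotent_component idemM.
Qed.
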